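(* Let $\mathcal G=(V,E,\mathbf W)$ be a finite undirected weighted graph with $N$ vertices, and let $\mathbf S$ be a fixed real symmetric graph shift on $\mathcal G$. If $\mathbf H$ is a polynomial filter of $\mathbf S$ and $\mathbf x$ is a stationary graph signal (with respect to $\mathbf S$), then $\mathbf H\mathbf x$ is also a stationary graph signal.
   Context: A graph shift on $\mathcal G$ is a matrix $\mathbf S=[S(i,j)]_{i,j\in V}$ with $S(i,j)=0$ unless $i=j$ or $(i,j)\in E$; here $\mathbf S$ is real and symmetric. A graph signal is a vector in $\mathbb R^V\cong\mathbb R^N$; a random graph signal is an $\mathbb R^N$-valued random vector (with finite second moments). A polynomial filter of $\mathbf S$ is a matrix of the form $\mathbf H=h(\mathbf S)=h_0\mathbf I+h_1\mathbf S+\dots+h_L\mathbf S^L$ for some polynomial $h$ with real coefficients. A random graph signal $\mathbf x$ is stationary if $\mathbb E\mathbf x=\mathbf 0$ and its covariance matrix $\mathrm{cov}(\mathbf x)=\mathbb E\big((\mathbf x-\mathbb E\mathbf x)(\mathbf x-\mathbb E\mathbf x)^\top\big)$ is a polynomial filter of $\mathbf S$. *)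

(* Defs.v *)
From HB Require Import structures.
From mathcomp Require Import all_boot all_order all_algebra.
From mathcomp Require Import all_classical all_reals all_analysis.

Set Implicit Arguments.
Unset Strict Implicit.
Unset Printing Implicit Defensive.

Import Order.TTheory GRing.Theory Num.Theory.
Import numFieldNormedType.Exports.

Local Open Scope ring_scope.

(* R^V is identified with R^N, N = #|V|, through the enumeration of V: the
   entry (i, j) of a V x V matrix A is A (enum_rank i) (enum_rank j). Weights
   are arbitrary reals supported on the edges, and loops are allowed. *)
Record weightedGraph (R : realType) (V : finType) := WeightedGraph {
  edge : rel V;
  weight : 'M[R]_#|V|;
  edge_sym : symmetric edge;
  weight_sym : weight^T = weight;
  weight_supp : forall i j : V,
    ~~ edge i j -> weight (enum_rank i) (enum_rank j) = 0
}.

Definition graph_shift (R : realType) (V : finType) (G : weightedGraph R V)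
    (S : 'M[R]_#|V|) : Prop :=
  forall i j : V, i != j -> ~~ edge G i j ->
    S (enum_rank i) (enum_rank j) = 0.

(* The sum is horner_mx S h, which the library only provides for matrices of
   size n.+1. *)
Definition polynomial_filter (R : realType) (n : nat) (S H : 'M[R]_n) : Prop :=
  exists h : {poly R}, H = \sum_(k < size h) h`_k *: S ^+ k.

Definition random_signal d (T : measurableType d) (R : realType)
    (P : probability T R) (n : nat) (x : T -> 'cV[R]_n) : Prop :=
  forall i, (fun w => x w i 0) \in Lfun P 2%:E.

(* fine sends an infinite expectation to 0; for a random_signal the entries
   of mean_mx and cov_mx below are expectations of integrable functions. *)
Definition mean_mx d (T : measurableType d) (R : realType)
    (P : probability T R) (m n : nat) (A : T -> 'M[R]_(m, n)) : 'M[R]_(m, n) :=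
  \matrix_(i, j) fine ('E_P[fun w => A w i j])%E.

Definition cov_mx d (T : measurableType d) (R : realType)
    (P : probability T R) (n : nat) (x : T -> 'cV[R]_n) : 'M[R]_n :=
  mean_mx P (fun w => (x w - mean_mx P x) *m (x w - mean_mx P x)^T).

Definition stationary d (T : measurableType d) (R : realType)
    (P : probability T R) (n : nat) (S : 'M[R]_n) (x : T -> 'cV[R]_n) : Prop :=
  [/\ random_signal P x, mean_mx P x = 0 & polynomial_filter S (cov_mx P x)].

(* Main.v *)
Require Import Defs.
From HB Require Import structures.
From mathcomp Require Import all_boot all_order all_algebra.
From mathcomp Require Import all_classical all_reals all_analysis.

Set Implicit Arguments.
Unset Strict Implicit.
Unset Printing Implicit Defensive.

Import Order.TTheory GRing.Theory Num.Theory.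
Import numFieldNormedType.Exports.

Local Open Scope ring_scope.

(** By linearity of the expectation, [E (H x) = H (E x)] and
    [cov (H x) = H (cov x) H^T]. As [S] is symmetric, so is every polynomial
    filter of [S]; hence [cov (H x) = H (cov x) H] is a product of polynomial
    filters, which corresponds to the product of the polynomials. *)

Lemma trmxX (R : comNzRingType) n (A : 'M[R]_n) k : (A ^+ k)^T = A^T ^+ k.
Proof.
elim: k => [|k IHk]; first by rewrite !expr0 trmx1.
by rewrite exprS [LHS]trmx_mul IHk exprSr.
Qed.

Lemma polynomial_filter_tr (R : realType) n (S H : 'M[R]_n) :
  S^T = S -> polynomial_filter S H -> H^T = H.
Proof.
move=> S_sym [h ->]; rewrite linear_sum; apply: eq_bigr => k _.
by rewrite linearZ /= trmxX S_sym.
Qed.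

(** Evaluation at [S] is a ring morphism, so it acts term by term on the expansion of [h] in powers
    of ['X]. In this form, products of filters come from products of polynomials. *)
Lemma polynomial_filter_horner_mx (R : realType) n (S H : 'M[R]_n.+1) :
  polynomial_filter S H <-> exists h, H = horner_mx S h.
Proof.
have hE h : horner_mx S h = \sum_(k < size h) h`_k *: S ^+ k.
  rewrite -{1}[h]coefK poly_def linear_sum; apply: eq_bigr => k _.
  by rewrite linearZ /= rmorphXn /= horner_mx_X.
by split=> -[h ->]; exists h; rewrite hE.
Qed.

Lemma polynomial_filter_mul (R : realType) n (S A B : 'M[R]_n) :
  polynomial_filter S A -> polynomial_filter S B -> polynomial_filter S (A *m B).
Proof.
(* There is only one matrix of size 0, so any polynomial is a witness there; positive sizes go
   through [horner_mx]. *)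
case: n S A B => [|n] S A B; first by exists 0; rewrite [LHS]flatmx0 [RHS]flatmx0.
move=> /polynomial_filter_horner_mx[a ->] /polynomial_filter_horner_mx[b ->].
by apply/polynomial_filter_horner_mx; exists (a * b); rewrite rmorphM.
Qed.

Section RandomMatrix.
Context d (T : measurableType d) (R : realType) (P : probability T R).

(** For [1 <= p] the space L^p is closed under [a *: u + v]. The case [p = 2] serves for the entries
    of signals, [p = 1] for those of outer products. *)
Lemma Lfun_lincomb (p : \bar R) (I : Type) (s : seq I) (a : I -> R) (X : I -> T -> R) :
  (1 <= p)%E -> (forall i, X i \in Lfun P p) ->
  (fun w => \sum_(i <- s) a i * X i w) \in Lfun P p.
Proof.
move=> p1 XL; have [L0 LD] := Lfun_submod_closed P p1.
elim: s => [|i s IHs].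
  rewrite (_ : (fun _ => _) = 0) //.
  by apply/funext => w; rewrite big_nil.
rewrite (_ : (fun _ => _) = a i *: X i + (fun w => \sum_(i <- s) a i * X i w)).
  exact: LD.
by apply/funext => w; rewrite big_cons.
Qed.

(** [fine] turns extended sums and products into real ones when the values are finite, which the
    integrability of the [X i] and of the partial sums ensures. *)
Lemma expectation_lincomb (I : Type) (s : seq I) (a : I -> R) (X : I -> T -> R) :
  (forall i, X i \in Lfun P 1) ->
  fine ('E_P[fun w => (\sum_(i <- s) a i * X i w)%R])%E =
  \sum_(i <- s) a i * fine ('E_P[X i])%E.
Proof.
move=> XL; elim: s => [|i s IHs].
  rewrite big_nil (_ : (fun _ => _) = cst 0) ?expectation_cst//.
  by apply/funext => w; rewrite big_nil.
(* [\o*] puts the scalar on the right, hence the [mulrC] below. *)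
rewrite (_ : (fun _ => _) =
    (a i \o* X i) \+ (fun w => \sum_(i <- s) a i * X i w)); last first.
  by apply/funext => w; rewrite big_cons /= mulrC.
have aXL : (a i \o* X i) \in Lfun P 1 by exact: Lfun_scale.
have sL := Lfun_lincomb s a (lexx _) XL.
rewrite expectationD// fineD ?expectation_fin_num// expectationZl// fineM//.
  by rewrite IHs big_cons.
exact: expectation_fin_num.
Qed.

Lemma mean_mx_mull m n q (B : 'M[R]_(q, m)) (A : T -> 'M[R]_(m, n)) :
  (forall i j, (fun w => A w i j) \in Lfun P 1) ->
  mean_mx P (fun w => B *m A w) = B *m mean_mx P A.
Proof.
move=> AL; apply/matrixP => i j; rewrite !mxE.
under eq_fun do rewrite mxE.
rewrite expectation_lincomb//.
by apply: eq_bigr => k _; rewrite mxE.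
Qed.

Lemma mean_mx_tr m n (A : T -> 'M[R]_(m, n)) :
  mean_mx P (fun w => (A w)^T) = (mean_mx P A)^T.
Proof.
by apply/matrixP => i j; rewrite !mxE; under eq_fun do rewrite mxE.
Qed.

(** Transposition reduces this to multiplication on the left. *)
Lemma mean_mx_mulr m n q (A : T -> 'M[R]_(m, n)) (B : 'M[R]_(n, q)) :
  (forall i j, (fun w => A w i j) \in Lfun P 1) ->
  mean_mx P (fun w => A w *m B) = mean_mx P A *m B.
Proof.
move=> AL; apply: trmx_inj; rewrite -mean_mx_tr trmx_mul -mean_mx_tr.
rewrite -mean_mx_mull => [|i j]; last by under eq_fun do rewrite mxE.
by under eq_fun do rewrite trmx_mul.
Qed.

(** A probability measure is finite, so L^2 is contained in L^1. *)
Lemma random_signal_Lfun1 n (x : T -> 'cV[R]_n) i :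
  random_signal P x -> (fun w => x w i 0) \in Lfun P 1.
Proof. by move=> xL; apply: Lfun_subset12 (xL i); exact: fin_num_measure. Qed.

Lemma random_signal_mulmx m n (B : 'M[R]_(m, n)) (x : T -> 'cV[R]_n) :
  random_signal P x -> random_signal P (fun w => B *m x w).
Proof.
move=> xL i; under eq_fun do rewrite mxE.
by apply: Lfun_lincomb; rewrite ?lee1n.
Qed.

Lemma random_signal_center n (x : T -> 'cV[R]_n) (c : 'cV[R]_n) :
  random_signal P x -> random_signal P (fun w => x w - c).
Proof.
move=> xL i; have le12 : (1 <= 2%:E :> \bar R)%E by rewrite lee1n.
have [_ LD] := Lfun_submod_closed P le12.
(* This is the shape [a *: u + v] of the closure property [LD]. *)
rewrite (_ : (fun _ => _) = -1 *: cst (c i 0) + (fun w => x w i 0)).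
  by apply: LD (xL i); exact: Lfun_cst.
by apply/funext => w; rewrite !mxE addrC -[- c i 0]mulN1r.
Qed.

Lemma mean_signal_mulmx m n (B : 'M[R]_(m, n)) (x : T -> 'cV[R]_n) :
  random_signal P x -> mean_mx P (fun w => B *m x w) = B *m mean_mx P x.
Proof.
by move=> xL; apply: mean_mx_mull => i j; rewrite ord1; exact: random_signal_Lfun1.
Qed.

(** By the Cauchy-Schwarz inequality, a product of two L^2 functions is integrable. *)
Lemma random_signal_outer n (x : T -> 'cV[R]_n) i j :
  random_signal P x -> (fun w => (x w *m (x w)^T) i j) \in Lfun P 1.
Proof.
move=> xL; rewrite (_ : (fun _ => _) =
    (fun w => x w i 0) \* (fun w => x w j 0)); last first.
  by apply/funext => w; rewrite mxE big_ord1 mxE.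
exact: Lfun2_mul_Lfun1.
Qed.

(** With [y] the centered signal, (B y)(B y)^T = B (y y^T) B^T, and constant matrices leave the
    expectation on either side. *)
Lemma cov_signal_mulmx m n (B : 'M[R]_(m, n)) (x : T -> 'cV[R]_n) :
  random_signal P x -> cov_mx P (fun w => B *m x w) = B *m cov_mx P x *m B^T.
Proof.
move=> xL; rewrite /cov_mx mean_signal_mulmx//.
have yL := random_signal_center (mean_mx P x) xL.
set y := fun w => x w - mean_mx P x in yL *.
have yyL i j := random_signal_outer i j yL.
(* On the right-hand side, [B^T] and then [B] are moved under the expectation. For [B], the entries
   of y y^T B^T must be integrable: they are linear combinations of those of y y^T. *)
rewrite -mulmxA -mean_mx_mulr// -[RHS]mean_mx_mull; last first.
  move=> i j; under eq_fun do (rewrite mxE; under eq_bigr do rewrite mulrC).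
  exact: Lfun_lincomb.
under eq_fun do rewrite -mulmxBr trmx_mul -!mulmxA.
by under [in RHS]eq_fun do rewrite -mulmxA.
Qed.

End RandomMatrix.

Theorem mainTheorem2 (R : realType) (V : finType) (G : weightedGraph R V)
    (S : 'M[R]_#|V|) (S_shift : graph_shift G S) (S_sym : S^T = S)
    (H : 'M[R]_#|V|) (H_filter : polynomial_filter S H)
    (d : measure_display) (T : measurableType d) (P : probability T R)
    (x : T -> 'cV[R]_#|V|) (x_stat : stationary P S x) :
  stationary P S (fun w => H *m x w).
Proof.
case: x_stat => xL x0 cov_filter; split.
- exact: random_signal_mulmx.
- by rewrite mean_signal_mulmx// x0 mulmx0.
- rewrite cov_signal_mulmx// (polynomial_filter_tr S_sym H_filter).
  by do 2?apply: polynomial_filter_mul.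
Qed.
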